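(* For every integer $n\ge 2$, the Lie group $SL_n(\mathbb{R})$ has Lie pseudo-exponent at most $2+\frac{2}{n}$.
   Context: For a subset $S$ of a group, $Q(S)=\{s_1s_2^{-1}: s_1,s_2\in S\}$. Let $G$ be a (real) Lie group with (nonempty) submanifolds $M_1,M_2,M_3$ such that for all $q_i\in Q(M_i)$, if $q_1q_2q_3=1$ then $q_1=q_2=q_3=1$. Then one says that $G$ has Lie pseudo-exponent at most $$\frac{\dim(G)}{(\dim(M_1)+\dim(M_2)+\dim(M_3))/3}.$$ Thus ''$G$ has Lie pseudo-exponent at most $c$'' means that there exist such submanifolds $M_1,M_2,M_3$, not all of dimension $0$, for which this ratio is at most $c$. *)

(* Defs.v *)
From mathcomp Require Import all_boot all_order all_algebra.
From mathcomp Require Import all_classical all_reals all_analysis.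

Set Implicit Arguments.
Unset Strict Implicit.
Unset Printing Implicit Defensive.

Import Order.TTheory GRing.Theory Num.Theory.
Import numFieldNormedType.Exports.

Local Open Scope classical_set_scope.
Local Open Scope ring_scope.

(* C^k on an open set [O].  Only used below for finite-dimensional [V] and [W];
   there a differentiable map has a C^k differential exactly when all of its
   directional derivatives are C^k. *)
Fixpoint Ck_on (R : realType) (V W : normedModType R) (k : nat)
    (O : set V) (f : V -> W) : Prop :=
  match k with
  | 0 => forall x, O x -> {for x, continuous f}
  | k'.+1 => (forall x, O x -> differentiable f x) /\
             (forall v : V, Ck_on k' O (fun x => 'D_v f x))
  end.

Definition smooth_on (R : realType) (V W : normedModType R)
    (O : set V) (f : V -> W) : Prop :=
  forall k, Ck_on k O f.

(* [M] is an embedded C^oo submanifold of R^(n x n), of pure dimension [d]: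
   every point of [M] has a neighbourhood [M `&` O] in [M] which is
   diffeomorphic to an open subset [U] of R^d.  Smoothness of a map defined on
   [M `&` O] means that it is the restriction of a smooth map on the ambient
   open set [O]. *)
Definition is_submanifold (R : realType) (n d : nat) (M : set 'M[R]_n) : Prop :=
  forall p, M p ->
  exists (O : set 'M[R]_n) (U : set 'rV[R]_d)
         (phi : 'M[R]_n -> 'rV[R]_d) (psi : 'rV[R]_d -> 'M[R]_n),
    [/\ open O, O p & open U] /\
    [/\ smooth_on O phi,
        smooth_on U psi,
        (forall x, M x -> O x -> U (phi x) /\ psi (phi x) = x) &
        (forall u, U u -> [/\ M (psi u), O (psi u) & phi (psi u) = u])].

(* A Lie group presented as a subgroup of GL_n(R) that is an embedded
   submanifold of R^(n x n).  Its multiplication and inversion are restrictions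
   of rational maps, hence automatically smooth. *)
Definition is_matrix_lie_group (R : realType) (n d : nat)
    (G : set 'M[R]_n) : Prop :=
  [/\ (forall A, G A -> A \in unitmx),
      G 1%:M,
      (forall A B, G A -> G B -> G (A *m B)),
      (forall A, G A -> G (invmx A)) &
      is_submanifold d G].

Definition Qset (R : realType) (n : nat) (S : set 'M[R]_n) : set 'M[R]_n :=
  [set q | exists s1 s2, [/\ S s1, S s2 & q = s1 *m invmx s2]].

(* Since [G] is embedded in R^(n x n), its embedded submanifolds are the
   embedded submanifolds of R^(n x n) contained in [G].  Dimensions of nonempty
   submanifolds are unique, so [dG], [d1], [d2], [d3] are determined. *)
Definition lie_pseudo_exponent_at_most (R : realType) (n : nat)
    (G : set 'M[R]_n) (c : R) : Prop :=
  exists (dG d1 d2 d3 : nat) (M1 M2 M3 : set 'M[R]_n),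
    is_matrix_lie_group dG G /\
    [/\ M1 `<=` G, M2 `<=` G & M3 `<=` G] /\
    [/\ M1 !=set0, M2 !=set0 & M3 !=set0] /\
    [/\ is_submanifold d1 M1, is_submanifold d2 M2 & is_submanifold d3 M3] /\
    (forall q1 q2 q3, Qset M1 q1 -> Qset M2 q2 -> Qset M3 q3 ->
       q1 *m q2 *m q3 = 1%:M -> [/\ q1 = 1%:M, q2 = 1%:M & q3 = 1%:M]) /\
    (0 < d1 + d2 + d3)%N /\
    dG%:R / ((d1%:R + d2%:R + d3%:R) / 3%:R) <= c.

Definition SL (R : realType) (n : nat) : set 'M[R]_n :=
  [set A | \det A = 1].
Arguments SL : clear implicits.

(* Main.v *)
(** The submanifolds are the group L of lower unitriangular matrices, the image O
    of skew-symmetric matrices under the Cayley transform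
    S |-> (1 - S)(1 + S)^-1, which is an open part of SO_n given by a single
    chart, and the group U of upper unitriangular matrices.  Each has dimension
    n(n-1)/2, so the ratio is (n^2 - 1) / (n(n-1)/2) = 2 + 2/n.  If l q u = 1
    with l in L, u in U and q in Q(O), then q is orthogonal and is the product
    of a lower and an upper unitriangular matrix, so its (1,1) entry is 1; as its
    first row and column have norm 1, they vanish off the diagonal, and
    induction on the index gives l = q = u = 1.

    All charts are rational maps.  Rational functions are differentiable where
    defined and are closed under directional derivatives, hence smooth.  Near a
    point where the (i,j) cofactor is nonzero, SL_n is the graph of a rational
    function giving the (i,j) entry in terms of the other entries. *)

Require Import Defs.
From mathcomp Require Import all_boot all_order all_algebra.
From mathcomp Require Import all_classical all_reals all_analysis.
From mathcomp Require Import ring lra.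
Import Order.TTheory GRing.Theory Num.Theory.
Import numFieldNormedType.Exports.
Local Open Scope classical_set_scope.
Local Open Scope ring_scope.

Set Implicit Arguments.
Unset Strict Implicit.
Unset Printing Implicit Defensive.

(** * Smoothness of rational maps *)

(** The first-order expansion of [f] at [x] is also one for [g]; uniqueness of the differential then
    identifies its linear part with that of [g]. *)
Lemma near_eq_differentiable (R : realType) (V W : normedModType R)
    (f g : V -> W) (x : V) :
  {near x, f =1 g} -> differentiable f x -> differentiable g x.
Proof.
move=> fg df; have [cdf dfE] := (diff_locallyP _ _).1 df.
have dg : g \o shift x = cst (g x) + 'd f x +o_ 0 id.
  apply/eqaddoP => e e0; move/eqaddoP: dfE => /(_ e e0) dfE.
  have fg0 : \forall h \near 0, f (h + x) = g (h + x).
    by have := fg; rewrite [X in X -> _](near_shift 0) subr0.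
  near=> h.
  have fgh : f (h + x) = g (h + x) by near: h.
  have -> : (g \o shift x - (cst (g x) + 'd f x)) h =
            (f \o shift x - (cst (f x) + 'd f x)) h.
    by rewrite !fctE /= fgh (nbhs_singleton fg).
  by near: h.
by apply/diff_locallyP; rewrite (diff_unique cdf dg).
Unshelve. all: by end_near. Qed.

(* [rational_eq] admits total functions with junk values outside [O], such as
   [invmx] at singular matrices. *)
Inductive rational_on (R : realType) (m n : nat) (O : set 'M[R]_(m, n)) :
    ('M[R]_(m, n) -> R) -> Prop :=
| rational_cst c : rational_on O (fun=> c)
| rational_coord i j : rational_on O (fun x => x i j)
| rational_add f g : rational_on O f -> rational_on O g ->
    rational_on O (fun x => f x + g x)
| rational_mul f g : rational_on O f -> rational_on O g ->
    rational_on O (fun x => f x * g x)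
| rational_inv f : (forall x, O x -> f x != 0) -> rational_on O f ->
    rational_on O (fun x => (f x)^-1)
| rational_eq f g : (forall x, O x -> g x = f x) -> rational_on O f ->
    rational_on O g.

Section RationalFunctions.
Variables (R : realType) (m n : nat) (O : set 'M[R]_(m, n)).
Implicit Types f g : 'M[R]_(m, n) -> R.

Lemma open_near_eq (T : Type) (f g : 'M[R]_(m, n) -> T) x :
  open O -> (forall y, O y -> g y = f y) -> O x -> {near x, f =1 g}.
Proof.
by move=> oO gf Ox; apply: filterS (open_nbhs_nbhs (conj oO Ox)) => y /gf.
Qed.

Lemma rational_on_differentiable f : open O -> rational_on O f ->
  forall x, O x -> differentiable f x.
Proof.
move=> oO.
elim=> [c|i j|{}f g _ IHf _ IHg|{}f g _ IHf _ IHg|{}f f0 _ IHf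
        |{}f g gf _ IHf] x Ox.
- exact: differentiable_cst.
- exact: differentiable_coord.
- exact: differentiableD (IHf x Ox) (IHg x Ox).
- exact: differentiableM (IHf x Ox) (IHg x Ox).
- exact: differentiableV (IHf x Ox) (f0 x Ox).
- exact: near_eq_differentiable (open_near_eq oO gf Ox) (IHf x Ox).
Qed.

(** The sum, product and inverse rules stay within rational functions. The derivative is matched on
    [O] only, which suffices to iterate since [O] is open. *)
Lemma rational_on_derive f v : open O -> rational_on O f ->
  exists2 g, rational_on O g & forall x, O x -> 'D_v f x = g x.
Proof.
move=> oO.
elim=> [c|i j|{}f1 f2 r1 [g1 rg1 d1] r2 [g2 rg2 d2]
        |{}f1 f2 r1 [g1 rg1 d1] r2 [g2 rg2 d2]|{}f f0 rf [g rg d]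
        |{}f g gf rf [h rh d]].
- exists (fun=> 0); first exact: rational_cst.
  by move=> x _; rewrite derive_cst.
- exists (fun=> v i j); first exact: rational_cst.
  move=> x _.
  have /diff_derivable D1 : differentiable (@idfun 'M[R]_(m, n)) x by [].
  have /= := @derive_mx _ _ _ _ _ x v (D1 v).
  by rewrite derive_id => /matrixP/(_ i j); rewrite mxE.
- exists (fun x => g1 x + g2 x); first exact: rational_add.
  move=> x Ox; rewrite -d1// -d2//.
  by apply: deriveD; apply: diff_derivable; apply: rational_on_differentiable.
- exists (fun x => f1 x * g2 x + f2 x * g1 x).
    by apply: rational_add; apply: rational_mul.
  move=> x Ox; rewrite -d1// -d2//.
  by apply: deriveM; apply: diff_derivable; apply: rational_on_differentiable.
- exists (fun x => (-1 * ((f x)^-1 * (f x)^-1)) * g x).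
    apply: rational_mul => //; apply: rational_mul; first exact: rational_cst.
    by apply: rational_mul; apply: rational_inv.
  move=> x Ox; rewrite -d// deriveV//; last first.
  - by apply: diff_derivable; apply: rational_on_differentiable.
  - exact: f0.
  by rewrite mulN1r -exprVn expr2.
- exists h => // x Ox; rewrite -d//; apply/esym/near_eq_derive.
  exact: open_near_eq.
Qed.

Lemma rational_on_opp f : rational_on O f -> rational_on O (fun x => - f x).
Proof.
move=> rf; rewrite (_ : (fun _ => _) = fun x => -1 * f x).
  by apply: rational_mul => //; exact: rational_cst.
by apply/funext => x; rewrite mulN1r.
Qed.

Lemma rational_on_sum (I : Type) (r : seq I) (P : pred I)
    (F : I -> 'M[R]_(m, n) -> R) :
  (forall i, rational_on O (F i)) ->
  rational_on O (fun x => \sum_(i <- r | P i) F i x).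
Proof.
move=> rF; elim: r => [|i r IH].
  under eq_fun do rewrite big_nil; exact: rational_cst.
under eq_fun do rewrite big_cons; case: (P i) => //; exact: rational_add.
Qed.

Lemma rational_on_prod (I : Type) (r : seq I) (P : pred I)
    (F : I -> 'M[R]_(m, n) -> R) :
  (forall i, rational_on O (F i)) ->
  rational_on O (fun x => \prod_(i <- r | P i) F i x).
Proof.
move=> rF; elim: r => [|i r IH].
  under eq_fun do rewrite big_nil; exact: rational_cst.
under eq_fun do rewrite big_cons; case: (P i) => //; exact: rational_mul.
Qed.

Definition rational_mx_on (p q : nat) (F : 'M[R]_(m, n) -> 'M[R]_(p, q)) :=
  forall i j, rational_on O (fun x => F x i j).

Lemma rational_on_det p (F : 'M[R]_(m, n) -> 'M[R]_p) :
  rational_mx_on F -> rational_on O (fun x => \det (F x)).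
Proof.
move=> rF; apply: rational_on_sum => s.
apply: rational_mul; first exact: rational_cst.
by apply: rational_on_prod => i; exact: rF.
Qed.

Lemma rational_on_cofactor p (F : 'M[R]_(m, n) -> 'M[R]_p) i j :
  rational_mx_on F -> rational_on O (fun x => cofactor (F x) i j).
Proof.
move=> rF; apply: rational_mul; first exact: rational_cst.
by apply: rational_on_det => k l; under eq_fun do rewrite !mxE; exact: rF.
Qed.

Lemma rational_mx_on_mul p q r (F : 'M[R]_(m, n) -> 'M[R]_(p, q))
    (G : 'M[R]_(m, n) -> 'M[R]_(q, r)) :
  rational_mx_on F -> rational_mx_on G ->
  rational_mx_on (fun x => F x *m G x).
Proof.
move=> rF rG i j; under eq_fun do rewrite mxE.
by apply: rational_on_sum => k; apply: rational_mul.
Qed.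

Lemma rational_mx_on_add p q (F G : 'M[R]_(m, n) -> 'M[R]_(p, q)) :
  rational_mx_on F -> rational_mx_on G -> rational_mx_on (fun x => F x + G x).
Proof.
by move=> rF rG i j; under eq_fun do rewrite mxE; exact: rational_add.
Qed.

Lemma rational_mx_on_opp p q (F : 'M[R]_(m, n) -> 'M[R]_(p, q)) :
  rational_mx_on F -> rational_mx_on (fun x => - F x).
Proof.
by move=> rF i j; under eq_fun do rewrite mxE; exact: rational_on_opp.
Qed.

Lemma rational_mx_on_scale p q f (F : 'M[R]_(m, n) -> 'M[R]_(p, q)) :
  rational_on O f -> rational_mx_on F -> rational_mx_on (fun x => f x *: F x).
Proof.
by move=> rf rF i j; under eq_fun do rewrite mxE; exact: rational_mul.
Qed.

Lemma rational_mx_on_cst p q (A : 'M[R]_(p, q)) : rational_mx_on (fun=> A).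
Proof. by move=> i j; exact: rational_cst. Qed.

Lemma rational_mx_on_id : rational_mx_on id.
Proof. by move=> i j; exact: rational_coord. Qed.

Lemma rational_mx_on_tr p q (F : 'M[R]_(m, n) -> 'M[R]_(p, q)) :
  rational_mx_on F -> rational_mx_on (fun x => (F x)^T).
Proof. by move=> rF i j; under eq_fun do rewrite mxE; exact: rF. Qed.

(** Cramer's rule. At a singular matrix [invmx] returns its argument, so the formula is only claimed
    on [O]. *)
Lemma rational_mx_on_invmx p (F : 'M[R]_(m, n) -> 'M[R]_p) :
  (forall x, O x -> F x \in unitmx) -> rational_mx_on F ->
  rational_mx_on (fun x => invmx (F x)).
Proof.
move=> uF rF i j.
apply: (@rational_eq _ _ _ _ (fun x => (\det (F x))^-1 * (\adj (F x)) i j)).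
  by move=> x Ox; rewrite /invmx uF// mxE.
apply: rational_mul.
  apply: rational_inv; last exact: rational_on_det.
  by move=> x /uF; rewrite unitmxE unitfE.
by under eq_fun do rewrite mxE; exact: rational_on_cofactor.
Qed.

Lemma rational_mx_on_differentiable p q (F : 'M[R]_(m, n) -> 'M[R]_(p, q)) :
  open O -> rational_mx_on F -> forall x, O x -> differentiable F x.
Proof.
move=> oO rF x Ox.
(* Expanding in elementary matrices reduces to scalar coefficients times constants. *)
rewrite (_ : F = \sum_(i < p) \sum_(j < q) (fun x => F x i j *: delta_mx i j)).
  apply: differentiable_sum => i; apply: differentiable_sum => j.
  apply: differentiableZl; exact: rational_on_differentiable (rF i j) x Ox.
apply/funext => y; rewrite {1}[F y]matrix_sum_delta fct_sumE.
by apply: eq_bigr => i _; rewrite fct_sumE.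
Qed.

Lemma rational_mx_on_smooth p q (F : 'M[R]_(m, n) -> 'M[R]_(p, q)) :
  open O -> rational_mx_on F -> smooth_on O F.
Proof.
move=> oO rF k; elim: k F rF => [|k IH] F rF.
  by move=> x Ox; apply/differentiable_continuous/rational_mx_on_differentiable.
split=> [x Ox|v]; first exact: rational_mx_on_differentiable.
(* Each directional derivative is again entrywise rational on [O], so the induction hypothesis,
   stated for all [F], applies to it. *)
apply: IH => i j; have [g rg dg] := rational_on_derive v oO (rF i j).
apply: rational_eq rg => x Ox; rewrite derive_mx ?mxE ?dg//.
exact/diff_derivable/rational_mx_on_differentiable.
Qed.
End RationalFunctions.

Lemma open_rational_neq0 (R : realType) m n (f : 'M[R]_(m, n) -> R) :
  rational_on setT f -> open [set x | f x != 0].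
Proof.
move=> rf; apply: (@open_comp _ _ f [set y | y != 0]); last exact: open_neq.
move=> x _; apply: differentiable_continuous.
by apply: (rational_on_differentiable openT rf).
Qed.

(** * The special linear group *)

Lemma enum_finset (T : finType) (S : {set T}) d : #|S| = d ->
  exists e : 'I_d -> T,
    injective e /\ forall p, (p \in S) <-> (exists k, e k = p).
Proof.
move=> <-; exists enum_val; split=> [|p]; first exact: enum_val_inj.
split=> [pS|[k <-]]; last exact: enum_valP.
by exists (enum_rank_in pS p); rewrite enum_rankK_in.
Qed.

(** * Matrices determined by a list of free entries *)

Section Coordinates.
Variables (R : realType) (n d : nat) (e : 'I_d -> 'I_n * 'I_n).
Hypothesis e_inj : injective e.

(** [e] lists the positions of the free entries: all but one for the charts of SL_n, those below the
    diagonal for the other three submanifolds. *)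
Definition fill (v : 'rV[R]_d) : 'M[R]_n :=
  \sum_k v 0 k *: delta_mx (e k).1 (e k).2.

Definition coords (A : 'M[R]_n) : 'rV[R]_d := \row_k A (e k).1 (e k).2.

Lemma fillE v i j : fill v i j = \sum_k v 0 k * ((i, j) == e k)%:R.
Proof.
rewrite /fill summxE; apply: eq_bigr => k _.
by rewrite !mxE [e k]surjective_pairing xpair_eqE.
Qed.

Lemma fill_eq0 v i j : (forall k, e k <> (i, j)) -> fill v i j = 0.
Proof.
move=> eN; rewrite fillE big1// => k _.
by case: eqP => [/esym/eN//|]; rewrite mulr0.
Qed.

Lemma fillK : cancel fill coords.
Proof.
move=> v; apply/rowP => k; rewrite mxE fillE (bigD1 k)//= -surjective_pairing.
rewrite eqxx mulr1 big1 ?addr0// => l lk.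
by rewrite (inj_eq e_inj) eq_sym (negbTE lk) mulr0.
Qed.

Lemma fill_coords (A : 'M[R]_n) i j : (exists k, e k = (i, j)) ->
  fill (coords A) i j = A i j.
Proof.
case=> k ek; have /rowP/(_ k) := fillK (coords A).
by rewrite !mxE ek.
Qed.

Lemma coordsD (A B : 'M[R]_n) : coords (A + B) = coords A + coords B.
Proof. by apply/rowP => k; rewrite !mxE. Qed.

Lemma coords_eq0 (A : 'M[R]_n) : (forall k, A (e k).1 (e k).2 = 0) -> coords A = 0.
Proof. by move=> A0; apply/rowP => k; rewrite !mxE. Qed.

Lemma rational_mx_on_fill p q (O : set 'M[R]_(p, q)) F :
  rational_mx_on O F -> rational_mx_on O (fun x => fill (F x)).
Proof.
move=> rF i j; under eq_fun do rewrite fillE.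
by apply: rational_on_sum => k; apply: rational_mul => //; exact: rational_cst.
Qed.

Lemma rational_mx_on_coords p q (O : set 'M[R]_(p, q)) F :
  rational_mx_on O F -> rational_mx_on O (fun x => coords (F x)).
Proof. by move=> rF i j; under eq_fun do rewrite mxE; exact: rF. Qed.

End Coordinates.

(** One global chart defined on all of R^d serves every point. *)
Lemma is_submanifold_range (R : realType) n d (O : set 'M[R]_n)
    (phi : 'M[R]_n -> 'rV[R]_d) (psi : 'rV[R]_d -> 'M[R]_n) :
  open O -> rational_mx_on O phi -> rational_mx_on setT psi ->
  (forall u, O (psi u)) -> cancel psi phi -> is_submanifold d (range psi).
Proof.
move=> oO rphi rpsi Opsi psiK _ [v _ <-].
exists O, setT, phi, psi; split; first by split=> //; exact: openT.
split.
- exact: rational_mx_on_smooth.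
- by apply: rational_mx_on_smooth => //; exact: openT.
- by move=> _ [u _ <-] _; rewrite psiK.
- by move=> u _; split=> //; exists u.
Qed.

Section SpecialLinear.
Variables (R : realType) (n : nat).

(** The cofactor deletes the row that is changed. Hence its nonvanishing can be tested on the free
    entries alone. *)
Lemma cofactor_delta (A : 'M[R]_n) (c : R) i j k l : i = k ->
  cofactor (A + c *: delta_mx i j) k l = cofactor A k l.
Proof.
move=> ->; rewrite /cofactor; congr (_ * \det _); apply/matrixP => a b.
by rewrite !mxE eq_sym (negbTE (neq_lift _ _)) mulr0 addr0.
Qed.

(** Laplace expansion along row [i]: the determinant is affine in a single entry, with the cofactor
    as slope. *)
Lemma det_delta (A : 'M[R]_n) (c : R) i j :
  \det (A + c *: delta_mx i j) = \det A + c * cofactor A i j.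
Proof.
rewrite (expand_det_row _ i) (expand_det_row A i).
under eq_bigr do rewrite cofactor_delta// !mxE eqxx mulrDl.
rewrite big_split /=; congr (_ + _).
rewrite (bigD1 j)//= eqxx mulr1 big1 ?addr0// => k kj.
by rewrite (negbTE kj) mulr0 mul0r.
Qed.

Lemma is_submanifold_SL : (0 < n)%N -> is_submanifold (n * n).-1 (SL R n).
Proof.
move=> n0 p detp.
(* If all cofactors vanished, expansion along the first row would give determinant 0 instead of
   1. *)
have [[i0 j0] cp] : exists ij, cofactor p ij.1 ij.2 != 0.
  apply/not_existsP => c0; have := oner_neq0 R; rewrite -detp.
  rewrite (expand_det_row _ (Ordinal n0)) big1 ?eqxx// => j _.
  by have /negP/negPn/eqP /= := c0 (Ordinal n0, j) => ->; rewrite mulr0.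
have [e [e_inj eP]] : exists e : 'I_(n * n).-1 -> 'I_n * 'I_n,
    injective e /\ forall q, q != (i0, j0) <-> exists k, e k = q.
  have [|e [e_inj eP]] := @enum_finset _ [set~ (i0, j0)]%SET (n * n).-1.
    by rewrite cardsC1 card_prod card_ord.
  by exists e; split=> // q; rewrite -eP !inE.
have eN k : e k <> (i0, j0).
  by move=> ek; have := (eP (i0, j0)).2 (ex_intro _ k ek); rewrite eqxx.
pose cof A : R := cofactor A i0 j0.
(* The coefficient solves [det_delta] for determinant 1; [fill e u] itself has entry 0 at
   [(i0, j0)]. *)
pose psi u :=
  fill e u + ((1 - \det (fill e u)) / cof (fill e u)) *: delta_mx i0 j0.
have coords_delta c : coords e (c *: delta_mx i0 j0) = 0 :> 'rV[R]__.
  apply: coords_eq0 => k; rewrite !mxE -xpair_eqE -surjective_pairing.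
  by case: eqP => [/eN//|]; rewrite mulr0.
have cof_rational : rational_on setT cof.
  by apply: rational_on_cofactor; exact: rational_mx_on_id.
have cofill_rational : rational_on setT (fun u => cof (fill e u)).
  by apply/rational_on_cofactor/rational_mx_on_fill/rational_mx_on_id.
exists [set A | cof A != 0], [set u | cof (fill e u) != 0], (coords e), psi.
have open_cofill := open_rational_neq0 cofill_rational.
split; first by split=> //; exact: open_rational_neq0.
split.
- apply: rational_mx_on_smooth; first exact: open_rational_neq0.
  exact/rational_mx_on_coords/rational_mx_on_id.
- apply: rational_mx_on_smooth => //.
  have rfill : rational_mx_on [set u | cof (fill e u) != 0] (fill e).
    exact/rational_mx_on_fill/rational_mx_on_id.
  apply: rational_mx_on_add => //; apply: rational_mx_on_scale.
    apply: rational_mul.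
      apply: rational_add; first exact: rational_cst.
      exact/rational_on_opp/rational_on_det.
    by apply: rational_inv => //; exact: rational_on_cofactor.
  exact: rational_mx_on_cst.
- move=> A detA cA.
  have AE : A = fill e (coords e A) + A i0 j0 *: delta_mx i0 j0.
    apply/matrixP => i j; rewrite !mxE -xpair_eqE.
    case: eqP => [[-> ->]|/eqP ne]; first by rewrite fill_eq0// add0r mulr1.
    by rewrite mulr0 addr0 fill_coords//; apply/eP.
  have cE : cof (fill e (coords e A)) = cof A.
    by rewrite [in RHS]AE /cof cofactor_delta.
  split; first by rewrite /= cE.
  rewrite [RHS]AE; congr (_ + _ *: _).
  rewrite -detA [in \det A]AE det_delta -/(cof _) addrC addKr mulfK//.
  by rewrite cE.
- move=> u cu; split; last by rewrite coordsD coords_delta addr0 fillK.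
    by rewrite /SL /= det_delta -/(cof _) divfK// addrC subrK.
  by rewrite /= /cof cofactor_delta.
Qed.

Lemma is_matrix_lie_group_SL : (0 < n)%N ->
  is_matrix_lie_group (n * n).-1 (SL R n).
Proof.
move=> n0; split.
- by move=> A detA; rewrite unitmxE detA unitr1.
- exact: det1.
- by move=> A B dA dB; rewrite /SL /= det_mulmx dA dB mulr1.
- by move=> A dA; rewrite /SL /= det_inv dA invr1.
- exact: is_submanifold_SL.
Qed.

End SpecialLinear.

(** * Unitriangular and orthogonal matrices *)

Section Unitriangular.
Variables (R : realType) (n : nat).
Implicit Types A B L V : 'M[R]_n.

Definition lower_unitri A :=
  forall i j : 'I_n, (i <= j)%N -> A i j = (i == j)%:R.

Lemma lower_unitri_det A : lower_unitri A -> \det A = 1.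
Proof.
move=> lA; rewrite det_trig; last first.
  apply/is_trig_mxP => i j ij; rewrite lA 1?ltnW//.
  by case: eqP ij => // ->; rewrite ltnn.
by apply: big1 => i _; rewrite lA ?eqxx.
Qed.

Lemma lower_unitri_unit A : lower_unitri A -> A \in unitmx.
Proof. by move=> /lower_unitri_det dA; rewrite unitmxE dA unitr1. Qed.

Lemma lower_unitri_mul A B :
  lower_unitri A -> lower_unitri B -> lower_unitri (A *m B).
Proof.
move=> lA lB i j ij; rewrite mxE (bigD1 i)//= lA// eqxx mul1r lB//.
rewrite big1 ?addr0// => k ki; have [ik|ik] := leqP i k.
  by rewrite lA// eq_sym (negbTE ki) mul0r.
rewrite lB ?(leq_trans (ltnW ik) ij)//.
by have /negbTE -> : k != j; [rewrite neq_ltn (leq_trans ik ij)|rewrite mulr0].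
Qed.

(** Compare the entries at [(i, j)] in [invmx A *m A = 1%:M]: terms with [k < j] vanish because [A]
    is lower triangular, those with [k > j] by induction, descending in the column [j]. *)
Lemma lower_unitri_inv A : lower_unitri A -> lower_unitri (invmx A).
Proof.
move=> lA i j; have [m] := ubnP (n - j).
elim: m j => // m IH j jm ij.
have /matrixP/(_ i j) := mulVmx (lower_unitri_unit lA).
rewrite mxE (bigD1 j)//= lA// eqxx mulr1 big1 => [|k kj].
  by rewrite addr0 mxE.
have [kj'|jk] := leqP k j; first by rewrite lA// (negbTE kj) mulr0.
rewrite IH; last 2 first.
- by rewrite -ltnS; apply: leq_trans jm; rewrite ltnS ltn_sub2l// (leq_trans jk)// ltnW.
- by rewrite (leq_trans ij)// ltnW.
have /negbTE -> : i != k; last by rewrite mul0r.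
by rewrite neq_ltn (leq_ltn_trans ij jk).
Qed.

(** The squares of the other coordinates sum to 0. *)
Lemma unit_vector_coord (w : 'I_n -> R) k : w k = 1 -> \sum_i w i ^+ 2 = 1 ->
  forall i, w i = (i == k)%:R.
Proof.
move=> wk; rewrite (bigD1 k)//= wk expr1n => /eqP.
rewrite -subr_eq0 [1 + _]addrC addrK psumr_eq0 => [/allP w0 i|i _]; last exact: sqr_ge0.
case: (eqVneq i k) => [->//|ik].
by have := w0 i (mem_index_enum _); rewrite ik sqrf_eq0 => /eqP.
Qed.

Lemma lower_upper_orthogonal L V : lower_unitri L -> lower_unitri V ->
  L *m V^T *m (L *m V^T)^T = 1%:M -> (L *m V^T)^T *m (L *m V^T) = 1%:M ->
  L = 1%:M /\ V = 1%:M.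
Proof.
set Q := L *m V^T => lL lV QQt QtQ.
suff LV k : forall i, L i k = (i == k)%:R /\ V i k = (i == k)%:R.
  by split; apply/matrixP => i j; rewrite mxE; have [] := LV j i.
have [m] := ubnP (k : nat); elim: m k => // m IH k km.
have QE i j : Q i j = \sum_l L i l * V j l.
  by rewrite mxE; apply: eq_bigr => l _; rewrite mxE.
(* In row [k] of [V] the entries right of the diagonal vanish by triangularity and those left of it
   by induction, so only [l = k] contributes. [Qrow] is the same with [L] and [V] exchanged. *)
have Qcol i : Q i k = L i k.
  rewrite QE (bigD1 k)//= lV// eqxx mulr1 big1 ?addr0// => l lk.
  have [kl|kl] := leqP k l; first by rewrite lV// eq_sym (negbTE lk) mulr0.
  by have [_ ->] := IH l (leq_trans kl km) k; rewrite eq_sym (negbTE lk) mulr0.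
have Qrow i : Q k i = V i k.
  rewrite QE (bigD1 k)//= lL// eqxx mul1r big1 ?addr0// => l lk.
  have [kl|kl] := leqP k l; first by rewrite lL// eq_sym (negbTE lk) mul0r.
  by have [-> _] := IH l (leq_trans kl km) k; rewrite eq_sym (negbTE lk) mul0r.
move=> i; split.
(* Column [k] of [Q] has norm 1 and a diagonal entry equal to 1. *)
- apply: (unit_vector_coord (w := L^~ k)); first by rewrite lL ?eqxx.
  have /matrixP/(_ k k) := QtQ; rewrite !mxE eqxx /= mulr1n => <-.
  by apply: eq_bigr => j _; rewrite [_^T _ _]mxE Qcol expr2.
- apply: (unit_vector_coord (w := V^~ k)); first by rewrite lV ?eqxx.
  have /matrixP/(_ k k) := QQt; rewrite !mxE eqxx /= mulr1n => <-.
  by apply: eq_bigr => j _; rewrite [_^T _ _]mxE Qrow expr2.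
Qed.

End Unitriangular.

(** * The Cayley transform of skew-symmetric matrices *)

Section Cayley.
Variables (R : realType) (n : nat).
Implicit Types S A : 'M[R]_n.

Definition cayley A : 'M[R]_n := (1%:M - A) *m invmx (1%:M + A).

(** For [v] in the left kernel, v v^T + v S v^T = 0. The scalar v S v^T equals its own negative by
    transposition, so the squared norm of [v] is 0. *)
Lemma skew_unitmx S : S^T = - S -> 1%:M + S \in unitmx.
Proof.
move=> skS; rewrite -row_free_unit -kermx_eq0; apply/eqP/row_matrixP => i.
rewrite row0; have : row i (kermx (1%:M + S)) *m (1%:M + S) = 0.
  by rewrite -row_mul mulmx_ker row0.
move: (row i _) => v vS.
have vSv0 : (v *m S *m v^T) 0 0 = 0.
  have : (v *m S *m v^T)^T 0 0 = - (v *m S *m v^T) 0 0.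
    by rewrite !trmx_mul trmxK skS mulNmx mulmxN mulmxA mxE.
  by rewrite mxE; lra.
have : (v *m (1%:M + S) *m v^T) 0 0 = 0 by rewrite vS mul0mx mxE.
rewrite mulmxDr mulmx1 mulmxDl mxE vSv0 addr0 mxE => /eqP.
rewrite psumr_eq0 => [/allP v0|j _]; last by rewrite mxE -expr2 sqr_ge0.
apply/rowP => j; have := v0 j (mem_index_enum _).
by rewrite mxE mulf_eq0 orbb => /eqP ->; rewrite mxE.
Qed.

Lemma addr_cayley S : 1%:M + S \in unitmx ->
  1%:M + cayley S = 2 *: invmx (1%:M + S).
Proof.
move=> uS; rewrite /cayley -{1}(mulmxV uS) -mulmxDl addrACA subrr addr0.
by rewrite -mulr2n -scaler_nat -scalemxAl mul1mx.
Qed.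

Lemma unitmx_addr_cayley S : 1%:M + S \in unitmx -> 1%:M + cayley S \in unitmx.
Proof.
move=> uS; rewrite addr_cayley// unitmxZ ?unitmx_inv//.
by rewrite unitfE pnatr_eq0.
Qed.

(** With C = [cayley S], both 1 - C and S(1 + C) equal 2S(1 + S)^-1. Thus the transform provides its
    own inverse chart. *)
Lemma cayleyK S : 1%:M + S \in unitmx -> cayley (cayley S) = S.
Proof.
move=> uS; rewrite [LHS]/cayley.
have -> : 1%:M - cayley S = S *m (1%:M + cayley S).
  rewrite addr_cayley// -scalemxAr scalemxAl /cayley -{1}(mulmxV uS).
  rewrite -mulmxBl; congr (_ *m _).
  by rewrite opprB addrC addrA subrK scaler_nat mulr2n.
by rewrite mulmxK// unitmx_addr_cayley.
Qed.

Lemma cayley_skewE S : S^T = - S ->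
  (cayley S)^T = invmx (1%:M - S) *m (1%:M + S).
Proof.
move=> skS; rewrite trmx_mul trmx_inv !linearD /= linearN /= trmx1 skS.
by rewrite opprK.
Qed.

Lemma skewN_unitmx S : S^T = - S -> 1%:M - S \in unitmx.
Proof. by move=> skS; apply: skew_unitmx; rewrite linearN /= skS. Qed.

Lemma cayley_skew_orthogonal S : S^T = - S -> (cayley S)^T *m cayley S = 1%:M.
Proof.
move=> skS; rewrite cayley_skewE// /cayley -!mulmxA (mulmxA (1%:M + S)).
(* The two middle factors commute, being polynomials in [S]; each then cancels against its
   inverse. *)
have -> : (1%:M + S) *m (1%:M - S) = (1%:M - S) *m (1%:M + S).
  rewrite [LHS]mulmxBr [RHS]mulmxBl mulmx1 mul1mx.
  by rewrite mulmxDl mulmxDr mulmx1 mul1mx.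
by rewrite mulmxK ?skew_unitmx// mulVmx// skewN_unitmx.
Qed.

(** 1 - S is the transpose of 1 + S, so numerator and denominator have the same determinant. *)
Lemma cayley_skew_det S : S^T = - S -> \det (cayley S) = 1.
Proof.
move=> skS; rewrite det_mulmx det_inv -(det_tr (1%:M + S)).
rewrite linearD /= trmx1 skS divff//.
by have := skewN_unitmx skS; rewrite unitmxE unitfE.
Qed.

End Cayley.

(** * Charts indexed by the positions below the diagonal *)

Lemma card_strict_lower n :
  #|[set p : 'I_n * 'I_n | (p.2 < p.1)%N]%SET| = 'C(n, 2).
Proof.
rewrite cardsE -sum1_card.
rewrite (eq_bigl (fun p : 'I_n * 'I_n => true && (p.2 < p.1)%N))//.
rewrite -(pair_big_dep xpredT (fun i j : 'I_n => (j < i)%N)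
  (fun=> fun=> 1%N)) /=.
(* Row [i], counted from 0, has [i] positions below the diagonal, and 0 + 1 + ... + (n - 1) is the
   binomial coefficient. *)
rewrite -bin2_sum big_mkord; apply: eq_bigr => i _.
rewrite -(big_ord_widen n (fun=> 1%N) (ltnW (ltn_ord i))).
by rewrite sum1_card card_ord.
Qed.

Section StrictlyLower.
Variables (R : realType) (n d : nat) (e : 'I_d -> 'I_n * 'I_n).
Hypothesis e_inj : injective e.
Hypothesis eP : forall p : 'I_n * 'I_n, (p.2 < p.1)%N <-> exists k, e k = p.

Let e_lt k : ((e k).2 < (e k).1)%N.
Proof. by apply/eP; exists k. Qed.

Lemma fill_upper0 (v : 'rV[R]_d) (i j : 'I_n) : (i <= j)%N -> fill e v i j = 0.
Proof.
move=> ij; apply: fill_eq0 => k ek.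
by have := e_lt k; rewrite ek /= ltnNge ij.
Qed.

Definition unitri_chart (v : 'rV[R]_d) : 'M[R]_n := 1%:M + fill e v.

Definition skew_chart (v : 'rV[R]_d) : 'M[R]_n := fill e v - (fill e v)^T.

Lemma unitri_chart_lower v : lower_unitri (unitri_chart v).
Proof. by move=> i j ij; rewrite mxE fill_upper0// addr0 mxE. Qed.

Lemma unitri_chartK : cancel unitri_chart (coords e).
Proof.
move=> v; rewrite coordsD fillK// coords_eq0 ?add0r// => k.
by rewrite mxE -val_eqE gtn_eqF ?e_lt.
Qed.

Lemma skew_chart_skew v : (skew_chart v)^T = - skew_chart v.
Proof. by rewrite /skew_chart linearB /= trmxK opprB. Qed.

(** [coords e] reads only entries below the diagonal, where the transposed part vanishes. *)
Lemma skew_chartK : cancel skew_chart (coords e).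
Proof.
move=> v; rewrite coordsD fillK// coords_eq0 ?addr0// => k.
by rewrite mxE mxE fill_upper0 ?oppr0// ltnW ?e_lt.
Qed.

Lemma rational_mx_on_unitri_chart : rational_mx_on setT unitri_chart.
Proof.
apply: rational_mx_on_add; first exact: rational_mx_on_cst.
exact/rational_mx_on_fill/rational_mx_on_id.
Qed.

Lemma is_submanifold_lower : is_submanifold d (range unitri_chart).
Proof.
apply: (@is_submanifold_range _ _ _ setT (coords e)) => //.
- exact: openT.
- exact/rational_mx_on_coords/rational_mx_on_id.
- exact: rational_mx_on_unitri_chart.
- exact: unitri_chartK.
Qed.

Lemma is_submanifold_upper :
  is_submanifold d (range (fun v => (unitri_chart v)^T)).
Proof.
apply: (@is_submanifold_range _ _ _ setT (coords e \o trmx)) => //.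
- exact: openT.
- exact/rational_mx_on_coords/rational_mx_on_tr/rational_mx_on_id.
- exact/rational_mx_on_tr/rational_mx_on_unitri_chart.
- by move=> v; rewrite /= trmxK unitri_chartK.
Qed.

Lemma rational_mx_on_cayley p q (O : set 'M[R]_(p, q)) (F : _ -> 'M[R]_n) :
  (forall x, O x -> 1%:M + F x \in unitmx) -> rational_mx_on O F ->
  rational_mx_on O (fun x => cayley (F x)).
Proof.
move=> uF rF; apply: rational_mx_on_mul.
  apply: rational_mx_on_add; first exact: rational_mx_on_cst.
  exact: rational_mx_on_opp.
apply: rational_mx_on_invmx => //.
by apply: rational_mx_on_add => //; exact: rational_mx_on_cst.
Qed.

Lemma is_submanifold_cayley :
  is_submanifold d (range (fun v => cayley (skew_chart v))).
Proof.
(* The open set is where -1 is not an eigenvalue, so that [cayley] is rational there. *)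
apply: (@is_submanifold_range _ _ _ [set A | \det (1%:M + A) != 0]
  (fun A => coords e (cayley A))).
- apply: open_rational_neq0; apply: rational_on_det; apply: rational_mx_on_add.
    exact: rational_mx_on_cst.
  exact: rational_mx_on_id.
- apply/rational_mx_on_coords/rational_mx_on_cayley => [A /=|].
    by rewrite unitmxE unitfE.
  exact: rational_mx_on_id.
- apply: rational_mx_on_cayley => [v _|].
    exact/skew_unitmx/skew_chart_skew.
  by apply: rational_mx_on_add; last apply/rational_mx_on_opp/rational_mx_on_tr;
    exact/rational_mx_on_fill/rational_mx_on_id.
- move=> v /=; rewrite -unitfE -unitmxE; apply: unitmx_addr_cayley.
  exact/skew_unitmx/skew_chart_skew.
- by move=> v; rewrite cayleyK ?skew_chartK//; exact/skew_unitmx/skew_chart_skew.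
Qed.

End StrictlyLower.

(** * The triple product condition *)

Section TripleProduct.
Variables (R : realType) (n : nat).
Implicit Types M : set 'M[R]_n.

Lemma Qset_lower M q : (forall A, M A -> lower_unitri A) -> Qset M q ->
  lower_unitri q.
Proof.
move=> lM [A [B [/lM lA /lM lB ->]]].
exact: lower_unitri_mul (lower_unitri_inv lB).
Qed.

Lemma Qset_upper M q : (forall A, M A -> lower_unitri A^T) -> Qset M q ->
  lower_unitri q^T.
Proof.
move=> lM [A [B [/lM lA /lM lB ->]]]; rewrite trmx_mul trmx_inv.
exact: lower_unitri_mul (lower_unitri_inv lB) _.
Qed.

Lemma Qset_orthogonal M q : (forall A, M A -> A^T *m A = 1%:M) -> Qset M q ->
  q^T *m q = 1%:M.
Proof.
move=> oM [A [B [/oM oA /oM oB ->]]].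
have [uB _] := mulmx1_unit (mulmx1C oB).
have BE : invmx B = B^T by rewrite -[LHS]mul1mx -oB mulmxK.
(* The product collapses to B A^T A B^T = B B^T. *)
rewrite BE trmx_mul trmxK mulmxA -(mulmxA B) oA mulmx1.
exact: mulmx1C.
Qed.

Lemma lower_orthogonal_upper (q1 q2 q3 : 'M[R]_n) :
  lower_unitri q1 -> q2^T *m q2 = 1%:M -> lower_unitri q3^T ->
  q1 *m q2 *m q3 = 1%:M -> [/\ q1 = 1%:M, q2 = 1%:M & q3 = 1%:M].
Proof.
move=> l1 o2 l3 q123.
have u1 := lower_unitri_unit l1.
have u3 : q3 \in unitmx by rewrite -unitmx_tr lower_unitri_unit.
(* Solving for [q2] gives a lower times an upper unitriangular matrix, the latter written as a
   transpose to fit [lower_upper_orthogonal]. *)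
have q2E : q2 = invmx q1 *m (invmx q3^T)^T.
  rewrite -trmx_inv trmxK; apply: (can_inj (mulKmx u1)); rewrite mulKVmx//.
  by apply: (can_inj (mulmxK u3)); rewrite q123 mulVmx.
have [] := lower_upper_orthogonal (lower_unitri_inv l1) (lower_unitri_inv l3).
- by rewrite -q2E; exact: mulmx1C.
- by rewrite -q2E.
move=> q1V q3V.
have inv1 (A : 'M[R]_n) : invmx A = 1%:M -> A = 1%:M.
  by move=> A1; rewrite -[A]invmxK A1 invmx1.
split; first exact: inv1.
  by rewrite q2E q1V q3V trmx1 mulmx1.
by rewrite -[q3]trmxK (inv1 _ q3V) trmx1.
Qed.

End TripleProduct.

(** * Choice of the submanifolds and dimension count *)

Theorem theorem6p1 (R : realType) (n : nat) (hn : (2 <= n)%N) :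
  lie_pseudo_exponent_at_most (SL R n) (2%:R + 2%:R / n%:R).
Proof.
have n0 : (0 < n)%N by exact: ltnW.
have [e [e_inj eS]] := enum_finset (card_strict_lower n).
have eP (p : 'I_n * 'I_n) : (p.2 < p.1)%N <-> exists k, e k = p.
  by rewrite -eS inE.
pose d := 'C(n, 2).
exists (n * n).-1, d, d, d, (range (@unitri_chart R _ _ e)),
  (range (fun v : 'rV[R]_d => cayley (skew_chart e v))),
  (range (fun v : 'rV[R]_d => (unitri_chart e v)^T)).
split; first exact: is_matrix_lie_group_SL.
split; first split.
- by move=> _ [v _ <-]; apply/lower_unitri_det/unitri_chart_lower.
- by move=> _ [v _ <-]; apply/cayley_skew_det/skew_chart_skew.
- move=> _ [v _ <-]; rewrite /SL /= det_tr.
  exact/lower_unitri_det/unitri_chart_lower.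
split; first by split; (eexists; exists 0 => //).
split; first split.
- exact: is_submanifold_lower.
- exact: is_submanifold_cayley.
- exact: is_submanifold_upper.
split.
  move=> q1 q2 q3 Q1 Q2 Q3; apply: lower_orthogonal_upper.
  - by apply: Qset_lower Q1 => _ [v _ <-]; exact: unitri_chart_lower.
  - apply: Qset_orthogonal Q2 => _ [v _ <-].
    exact/cayley_skew_orthogonal/skew_chart_skew.
  - by apply: Qset_upper Q3 => _ [v _ <-]; rewrite trmxK; exact: unitri_chart_lower.
(* Here [2 <= n] enters: for n = 1 all three dimensions would be 0. *)
have d0 : (0 < d)%N by rewrite bin_gt0.
split; first by rewrite addn_gt0 d0 orbT.
have dE : d%:R * 2 = n%:R * (n%:R - 1) :> R.
  by rewrite mulrC -natrM -(mul_bin_diag n 1) bin1 natrM -subn1 natrB.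
have nE : (n * n).-1%:R = n%:R * n%:R - 1 :> R.
  by rewrite -subn1 natrB ?natrM// muln_gt0 n0.
have dR : 0 < d%:R :> R by rewrite ltr0n.
have nR : 0 < n%:R :> R by rewrite ltr0n.
rewrite nE (_ : (d%:R + d%:R + d%:R) / 3 = d%:R :> R); last by field.
(* The bound is attained: n^2 - 1 = (2 + 2/n) n(n - 1)/2. *)
rewrite ler_pdivrMr// le_eqVlt; apply/orP; left; apply/eqP.
have -> : d%:R = n%:R * (n%:R - 1) / 2 :> R by rewrite -dE mulfK// pnatr_eq0.
by field; rewrite gt_eqF.
Qed.
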